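(* Let $n\ge 2$, let $G$ be a subgroup of $B_n$, let $F_n\rtimes G$ denote the subgroup of $F_n\rtimes B_n$ generated by $F_n$ and $G$, and let $\rho\colon F_n\rtimes G\to\mathrm{GL}(V)$ be a representation on a finite-dimensional complex vector space $V$, extended linearly to $\mathbf{Z}[F_n\rtimes G]\to\mathrm{End}(V)$. For $\beta\in G$, every entry of $\phi(\beta)$ lies in $\mathbf{Z}[F_n\rtimes G]$, and the map $\rho^+\colon G\to\mathrm{GL}(V^{\oplus n})$ sending $\beta$ to the block matrix whose $(k,l)$ block is $\rho(\phi(\beta)_{kl})$ is a well-defined representation of $G$.
   Context: The braid group $B_n$ has generators $\sigma_1,\dots,\sigma_{n-1}$ with relations $\sigma_i\sigma_j=\sigma_j\sigma_i$ for $|i-j|>1$ and $\sigma_i\sigma_j\sigma_i=\sigma_j\sigma_i\sigma_j$ for $|i-j|=1$. Let $F_n$ be the free group on $g_1,\dots,g_n$. The semidirect product $F_n\rtimes B_n$ is the group generated by $F_n$ and $B_n$ subject to the additional relations $g_{i+1}\sigma_i=\sigma_i g_i$, $g_i\sigma_i=\sigma_i g_i g_{i+1}g_i^{-1}$, and $g_j\sigma_i=\sigma_i g_j$ for $j\notin\{i,i+1\}$. For $i=1,\dots,n-1$ let $R_i=\begin{bmatrix}0&g_i\\1&1-g_i\end{bmatrix}$ (entries in the group ring $\mathbf{Z}[F_n\rtimes B_n]$). Let $\phi$ be the homomorphism from $B_n$ to the group of invertible $n\times n$ matrices over $\mathbf{Z}[F_n\rtimes B_n]$ (usual matrix multiplication)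 given by $\phi(\sigma_i)=\sigma_i\cdot\mathrm{diag}(I_{i-1},R_i,I_{n-i-1})$, where the scalar $\sigma_i$ multiplies every entry on the left. *)

(* Defs.v *)
(* Groups given by presentations are modelled by words
   modulo the congruence generated by free cancellation and the defining
   relations; the group ring Z[Gamma] by formal Z-combinations of words. *)
From HB Require Import structures.
From mathcomp Require Import all_boot all_order all_algebra.
From mathcomp Require Import boolp reals.
From mathcomp.real_closed Require Import complex.
Set Implicit Arguments.
Unset Strict Implicit.
Unset Printing Implicit Defensive.
Import Order.TTheory GRing.Theory Num.Theory.

(* Generators of F_n ⋊ B_n, 0-based:
   gF k  stands for g_(k+1)      (valid when k < n),
   gB i  stands for sigma_(i+1)  (valid when i < n-1). *)
Inductive gen := gF of nat | gB of nat.

(* A letter is a generator together with an exponent sign: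
   (x, false) = x, (x, true) = x^-1. *)
Definition letter := (gen * bool)%type.
Definition word := seq letter.

Definition lg (k : nat) : word := [:: (gF k, false)].
Definition lgi (k : nat) : word := [:: (gF k, true)].
Definition ls (i : nat) : word := [:: (gB i, false)].
Definition lsi (i : nat) : word := [:: (gB i, true)].

Definition winv (w : word) : word := rev [seq (l.1, ~~ l.2) | l <- w].

Inductive defrel (n : nat) : word -> word -> Prop :=
| rel_far i j : i < n.-1 -> j < n.-1 -> (i.+1 < j) || (j.+1 < i) ->
    defrel n (ls i ++ ls j) (ls j ++ ls i)
| rel_adj i j : i < n.-1 -> j < n.-1 -> (i.+1 == j) || (j.+1 == i) ->
    defrel n (ls i ++ ls j ++ ls i) (ls j ++ ls i ++ ls j)
| rel_g1 i : i < n.-1 ->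
    defrel n (lg i.+1 ++ ls i) (ls i ++ lg i)
| rel_g2 i : i < n.-1 ->
    defrel n (lg i ++ ls i) (ls i ++ lg i ++ lg i.+1 ++ lgi i)
| rel_g3 i j : i < n.-1 -> j < n -> j != i -> j != i.+1 ->
    defrel n (lg j ++ ls i) (ls i ++ lg j).

Inductive weq (n : nat) : word -> word -> Prop :=
| weq_refl w : weq n w w
| weq_sym u v : weq n u v -> weq n v u
| weq_trans u v w : weq n u v -> weq n v w -> weq n u w
| weq_cat u u' v v' : weq n u u' -> weq n v v' -> weq n (u ++ v) (u' ++ v')
| weq_cancel x b : weq n [:: (x, b); (x, ~~ b)] [::]
| weq_rel u v : defrel n u v -> weq n u v.

Definition braid_word (n : nat) (w : word) : bool :=
  all (fun l => if l.1 is gB i then i < n.-1 else false) w.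

(* G is a subgroup of B_n, given as the set of braid words representing
   its elements (closed under equality in the group). *)
Definition braid_subgroup (n : nat) (G : word -> Prop) : Prop :=
  [/\ forall w, G w -> braid_word n w,
      G [::],
      forall u v, G u -> G v -> G (u ++ v),
      forall w, G w -> G (winv w)
    & forall u v, G u -> braid_word n v -> weq n u v -> G v].

Inductive inFG (n : nat) (G : word -> Prop) : word -> Prop :=
| inFG_g k : k < n -> inFG n G (lg k)
| inFG_G w : G w -> inFG n G w
| inFG_nil : inFG n G [::]
| inFG_cat u v : inFG n G u -> inFG n G v -> inFG n G (u ++ v)
| inFG_inv w : inFG n G w -> inFG n G (winv w)
| inFG_weq u v : weq n u v -> inFG n G u -> inFG n G v.

Definition gring := seq (int * word).
Definition gr0 : gring := [::].
Definition gr1 : gring := [:: (1%R, [::])].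
Definition grw (c : int) (w : word) : gring := [:: (c, w)].
Definition gradd (x y : gring) : gring := x ++ y.
Definition grmul (x y : gring) : gring :=
  [seq (p.1 * q.1, p.2 ++ q.2)%R | p <- x, q <- y].
Definition grlmul (w : word) (x : gring) : gring := [seq (p.1, w ++ p.2) | p <- x].
Definition grrmul (x : gring) (w : word) : gring := [seq (p.1, p.2 ++ w) | p <- x].

Definition grcoef (n : nat) (x : gring) (w : word) : int :=
  (\sum_(p <- x | `[< weq n p.2 w >]) p.1)%R.

Definition in_ZFG (n : nat) (G : word -> Prop) (x : gring) : Prop :=
  forall w, grcoef n x w != 0%R -> inFG n G w.

Definition grmx_mul (n : nat) (A B : 'M[gring]_n) : 'M[gring]_n :=
  \matrix_(i, j) \big[cat/[::]]_(k < n) grmul (A i k) (B k j).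
Definition grmx_one (n : nat) : 'M[gring]_n :=
  \matrix_(i, j) (if i == j then gr1 else gr0).

(* phi(sigma_(i+1)) = sigma_(i+1) . diag(I, R, I), with
   R = [[0, g], [1, 1 - g]], g = g_(i+1); rows/columns i, i+1 (0-based). *)
Definition Dmx (n i : nat) : 'M[gring]_n :=
  \matrix_(a, b)
    if (a == i :> nat) && (b == i :> nat) then gr0
    else if (a == i :> nat) && (b == i.+1 :> nat) then grw 1 (lg i)
    else if (a == i.+1 :> nat) && (b == i :> nat) then gr1
    else if (a == i.+1 :> nat) && (b == i.+1 :> nat) then gradd gr1 (grw (-1) (lg i))
    else if a == b then gr1 else gr0.
(* its inverse diag(I, R^-1, I), R^-1 = [[1 - g^-1, 1], [g^-1, 0]] *)
Definition Dinvmx (n i : nat) : 'M[gring]_n :=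
  \matrix_(a, b)
    if (a == i :> nat) && (b == i :> nat) then gradd gr1 (grw (-1) (lgi i))
    else if (a == i :> nat) && (b == i.+1 :> nat) then gr1
    else if (a == i.+1 :> nat) && (b == i :> nat) then grw 1 (lgi i)
    else if (a == i.+1 :> nat) && (b == i.+1 :> nat) then gr0
    else if a == b then gr1 else gr0.

Definition phi_letter (n : nat) (l : letter) : 'M[gring]_n :=
  match l with
  | (gB i, false) => \matrix_(a, b) grlmul (ls i) (Dmx n i a b)
  | (gB i, true) => \matrix_(a, b) grrmul (Dinvmx n i a b) (lsi i)
  | _ => grmx_one n
  end.

Definition phi (n : nat) (w : word) : 'M[gring]_n :=
  foldr (fun l M => grmx_mul (phi_letter n l) M) (grmx_one n) w.

Definition rho_lin (K : pzRingType) (d n : nat) (G : word -> Prop)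
    (rho : word -> 'M[K]_d) (x : gring) : 'M[K]_d :=
  (\sum_(p <- x | `[< inFG n G p.2 >]) (p.1)%:~R *: rho p.2)%R.

Definition rho_plus (K : pzRingType) (d n : nat) (G : word -> Prop)
    (rho : word -> 'M[K]_d) (beta : word) : 'M[K]_(\sum_(k < n) d) :=
  @mxblock K n n (fun=> d) (fun=> d)
    (fun k l => rho_lin n G rho (phi n beta k l)).

(* Main.v *)
Require Import Defs.
From HB Require Import structures.
From mathcomp Require Import all_boot all_order all_algebra.
From mathcomp Require Import boolp reals.
From mathcomp.real_closed Require Import complex.
From mathcomp Require Import zify.
From Stdlib Require Import Setoid Morphisms.

(* Z[Gamma] acts on functions on Gamma by right translation, so phi(beta) acts
   on families (H_k) of such functions.  On the generators this action is given
   by short explicit formulas, and phi respects the defining relations as soon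
   as these operators do, which is a check row by row.  The operator of beta at
   u reads H only on the coset u beta F_n, since F_n is normal: hence the
   entries of phi(beta) are supported in F_n G, where rho is multiplicative.
   The (k, l) block of rho^+(beta) is the value at 1 of the k-th component of
   phi(beta) applied to the family with rho, extended by 0, in position l and 0
   elsewhere. *)

Set Implicit Arguments.
Unset Strict Implicit.
Unset Printing Implicit Defensive.
Import GRing.Theory.

(** * Words modulo the defining relations *)

#[local] Instance weq_equivalence n : Equivalence (weq n).
Proof. by split; [apply: weq_refl | apply: weq_sym | apply: weq_trans]. Qed.

#[local] Instance cons_weq_proper n l : Proper (weq n ==> weq n) (cons l).
Proof.
by move=> u v uv; apply: (@weq_cat _ [:: l] [:: l]) => //; apply: weq_refl.
Qed.

#[local] Instance cat_weq_proper n :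
  Proper (weq n ==> weq n ==> weq n) (@cat letter).
Proof. by move=> u u' uu' v v' vv'; apply: weq_cat. Qed.

#[local] Hint Resolve weq_refl : core.

Lemma weq_winvr n w : weq n (w ++ winv w) [::].
Proof.
elim: w => [|[x b] w IHw]; first exact: weq_refl.
rewrite /winv /= rev_cons -cats1 catA -cat_cons.
by rewrite -/(winv w) /= IHw; apply: weq_cancel.
Qed.

Lemma winvK : involutive winv.
Proof.
move=> w; rewrite /winv map_rev revK -map_comp -[RHS]map_id.
by apply: eq_map => -[x b] /=; rewrite negbK.
Qed.

Lemma weq_winvl n w : weq n (winv w ++ w) [::].
Proof. by rewrite -{2}[w]winvK; apply: weq_winvr. Qed.

(** The hypothesis makes [z] the conjugate of [x] by [y], and conjugation commutes with
    inversion. *)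
Lemma weq_conj_winv n x y z :
  weq n (x ++ y) (y ++ z) -> weq n (winv x ++ y) (y ++ winv z).
Proof.
move=> xy; have e : weq n (winv x ++ y) (winv x ++ (y ++ z) ++ winv z).
  by rewrite -!catA weq_winvr cats0.
by rewrite e -xy !catA weq_winvl.
Qed.

Lemma weq_conj_sym n x y z :
  weq n (x ++ y) (y ++ z) -> weq n (z ++ winv y) (winv y ++ x).
Proof.
move=> xy; have e : weq n (z ++ winv y) (winv y ++ (y ++ z) ++ winv y).
  by rewrite !catA weq_winvl.
by rewrite e -xy -!catA weq_winvr cats0.
Qed.

Lemma weq_cancel_cons n x b w : weq n ((x, b) :: (x, ~~ b) :: w) w.
Proof. exact: (weq_cat (weq_cancel n x b) (weq_refl n w)). Qed.

Lemma weq_rel_cat n u v w : defrel n u v -> weq n (u ++ w) (v ++ w).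
Proof. by move=> uv; rewrite (weq_rel uv). Qed.

(** * The operators of braid words on families of functions *)

Section WordAction.
Variable n : nat.

(* [sigma_op] and [sigmaV_op] are phi(sigma_i) and phi(sigma_i^-1) acting on
   column vectors of functions on the group, a word [v] acting on such a
   function by right translation [u |-> u ++ v]. *)
Section Operators.
Variable V : zmodType.
Implicit Types H : nat -> word -> V.
Local Open Scope ring_scope.

Definition sigma_op (i : nat) H : nat -> word -> V := fun k u =>
  if k == i then H i.+1 (u ++ ls i ++ lg i)
  else if k == i.+1 then
    H i (u ++ ls i) + H i.+1 (u ++ ls i) - H i.+1 (u ++ ls i ++ lg i)
  else H k (u ++ ls i).

Definition sigmaV_op (i : nat) H : nat -> word -> V := fun k u =>
  if k == i then
    H i (u ++ lsi i) - H i (u ++ lgi i ++ lsi i) + H i.+1 (u ++ lsi i)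
  else if k == i.+1 then H i (u ++ lgi i ++ lsi i)
  else H k (u ++ lsi i).

(* Equal words may differ by cancelling letters outside the presentation, and
   [Dmx n n.-1] is singular, so braid letters out of range act trivially; so do
   free letters, because phi factors through F_n ⋊ B_n -> B_n. *)
Definition letter_op (l : letter) H : nat -> word -> V :=
  match l with
  | (gB i, b) =>
      if (i < n.-1)%N then if b then sigmaV_op i H else sigma_op i H else H
  | _ => H
  end.

Definition word_op (w : word) H := foldr letter_op H w.

Definition weq_inv H := forall k u v, weq n u v -> H k u = H k v.

Lemma word_op_cat u v H : word_op (u ++ v) H = word_op u (word_op v H).
Proof. exact: foldr_cat. Qed.

Lemma letter_op_inv l H : weq_inv H -> weq_inv (letter_op l H).
Proof.
move=> Hi; case: l => [[j|i] b] //=; case: ifP => // _.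
have Hc k u v w : weq n u v -> H k (u ++ w) = H k (v ++ w).
  by move=> uv; apply: (Hi); rewrite uv.
by case: b => k u v uv; rewrite /sigma_op /sigmaV_op !(Hc _ _ _ _ uv).
Qed.

Lemma word_op_inv w H : weq_inv H -> weq_inv (word_op w H).
Proof. by move=> Hi; elim: w => //= l w IHw; apply: letter_op_inv. Qed.

Lemma weq_inv_cat H k u v w : weq_inv H -> weq n v w ->
  H k (u ++ v) = H k (u ++ w).
Proof. by move=> Hi vw; apply: (Hi); rewrite vw. Qed.

Lemma sigma_opK i H : weq_inv H -> sigmaV_op i (sigma_op i H) = H.
Proof.
move=> Hi; apply/funext => k; apply/funext => u.
have E m x b w : H m (u ++ (x, b) :: (x, ~~ b) :: w) = H m (u ++ w).
  by apply: weq_inv_cat => //; rewrite weq_cancel_cons.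
have E2 m x y b c :
    H m (u ++ [:: (x, b); (y, c); (y, ~~ c); (x, ~~ b)]) = H m u.
  rewrite -[in RHS](cats0 u).
  by apply: weq_inv_cat => //; rewrite !weq_cancel_cons.
rewrite /sigma_op /sigmaV_op !eqxx !(gtn_eqF (ltnSn i)) -!catA /=.
rewrite !(E _ (gB i) true) !(E2 _ (gF i) (gB i) true true) !cats0.
case: eqP => [->|_]; first by rewrite addrC subrKA addrK.
by case: eqP => [->|_].
Qed.

Lemma sigmaV_opK i H : weq_inv H -> sigma_op i (sigmaV_op i H) = H.
Proof.
move=> Hi; apply/funext => k; apply/funext => u.
have E m x b w : H m (u ++ (x, b) :: (x, ~~ b) :: w) = H m (u ++ w).
  by apply: weq_inv_cat => //; rewrite weq_cancel_cons.
have E2 m x y b c :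
    H m (u ++ [:: (x, b); (y, c); (y, ~~ c); (x, ~~ b)]) = H m u.
  rewrite -[in RHS](cats0 u).
  by apply: weq_inv_cat => //; rewrite !weq_cancel_cons.
rewrite /sigma_op /sigmaV_op !eqxx !(gtn_eqF (ltnSn i)) -!catA /=.
rewrite !(E _ (gB i) false) !(E2 _ (gB i) (gF i) false false) !cats0.
case: eqP => [->|_] //; case: eqP => [->|_] //.
by rewrite (addrAC (H i u)) subrK addrAC subrr add0r.
Qed.

Lemma sigma_op_far (i j : nat) H :
  (i < n.-1)%N -> (j < n.-1)%N -> (i.+1 < j)%N -> weq_inv H ->
  sigma_op i (sigma_op j H) = sigma_op j (sigma_op i H).
Proof.
move=> lti ltj ltij Hi; apply/funext => k; apply/funext => u.
rewrite /sigma_op.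
have [lt1 lt2 lt3] : [/\ i < j, i < j.+1 & i.+1 < j.+1]%N by split; lia.
rewrite ?(ltn_eqF ltij) ?(ltn_eqF lt1) ?(ltn_eqF lt2) ?(ltn_eqF lt3).
rewrite ?(gtn_eqF ltij) ?(gtn_eqF lt1) ?(gtn_eqF lt2) ?(gtn_eqF lt3).
rewrite -!catA /=.
have st w : weq n [:: (gB i, false), (gB j, false) & w]
                  [:: (gB j, false), (gB i, false) & w].
  by apply: (weq_rel_cat w (@rel_far n i j _ _ _)); rewrite ?ltij.
have E0 m : H m (u ++ (gB i, false) :: ls j) =
            H m (u ++ (gB j, false) :: ls i).
  by apply: weq_inv_cat => //; apply: st.
have Ei m : H m (u ++ [:: (gB i, false), (gF i, false) & ls j]) =
            H m (u ++ [:: (gB j, false), (gB i, false) & lg i]).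
  apply: weq_inv_cat => //; rewrite -st.
  have gs : weq n (lg i ++ ls j) (ls j ++ lg i) by apply/weq_rel/rel_g3; lia.
  exact: cons_weq_proper.
have Ej m : H m (u ++ [:: (gB i, false), (gB j, false) & lg j]) =
            H m (u ++ [:: (gB j, false), (gF j, false) & ls i]).
  apply: weq_inv_cat => //; rewrite st.
  have gs : weq n (lg j ++ ls i) (ls i ++ lg j) by apply/weq_rel/rel_g3; lia.
  by apply: cons_weq_proper; symmetry.
rewrite !E0 !Ei !Ej.
case: (eqVneq k i) => [->|ki].
  by rewrite (ltn_eqF lt1) (ltn_eqF lt2).
case: (eqVneq k i.+1) => [->|ki1] //.
by rewrite (ltn_eqF ltij) (ltn_eqF lt3).
Qed.

Lemma sigma_op_braid (i : nat) H : (i.+1 < n.-1)%N -> weq_inv H ->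
  sigma_op i (sigma_op i.+1 (sigma_op i H)) =
  sigma_op i.+1 (sigma_op i (sigma_op i.+1 H)).
Proof.
move=> lti Hi; apply/funext => k; apply/funext => u.
have [lt1 lt2 lt3] : [/\ i < i.+1, i.+1 < i.+2 & i < i.+2]%N by [].
rewrite /sigma_op !eqxx (ltn_eqF lt1) ?(ltn_eqF lt2) ?(ltn_eqF lt3).
rewrite ?(gtn_eqF lt1) ?(gtn_eqF lt2) ?(gtn_eqF lt3).
rewrite -!catA /=.
pose a := (gF i, false); pose b := (gF i.+1, false).
pose s := (gB i, false); pose t := (gB i.+1, false).
have sts w : weq n [:: s, t, s & w] [:: t, s, t & w].
  by apply: (weq_rel_cat w (@rel_adj n i i.+1 _ _ _)); lia.
have bs w : weq n [:: b, s & w] [:: s, a & w].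
  by apply: (weq_rel_cat w (@rel_g1 n i _)); lia.
have at_ w : weq n [:: a, t & w] [:: t, a & w].
  by apply: (weq_rel_cat w (@rel_g3 n i.+1 i _ _ _ _)); lia.
have as_ w : weq n [:: a, s & w] [:: s, a, b, (gF i, true) & w].
  by apply: (weq_rel_cat w (@rel_g2 n i _)); lia.
have E0 m : H m (u ++ [:: s; t; s]) = H m (u ++ [:: t; s; t]).
  by apply: weq_inv_cat => //; rewrite sts.
have E1 m : H m (u ++ [:: s; t; s; a]) = H m (u ++ [:: t; s; t; a]).
  by apply: weq_inv_cat => //; rewrite sts.
have E2 m : H m (u ++ [:: s; t; b; s]) = H m (u ++ [:: t; s; t; a]).
  by apply: weq_inv_cat => //; rewrite bs sts.
(* The inverse letter produced by moving [a] past [s] cancels against the [a] left behind when [b]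
   passes [s]. *)
have E3 m : H m (u ++ [:: s; a; t; b; s]) = H m (u ++ [:: t; s; t; a; b]).
  apply: weq_inv_cat => //.
  by rewrite bs at_ as_ sts (weq_cancel_cons _ _ true).
have E4 m : H m (u ++ [:: t; b; s; t]) = H m (u ++ [:: t; s; t; a]).
  by apply: weq_inv_cat => //; rewrite bs at_.
have E5 m : H m (u ++ [:: t; s; a; t; b]) = H m (u ++ [:: t; s; t; a; b]).
  by apply: weq_inv_cat => //; rewrite at_.
have E6 m : H m (u ++ [:: t; b; s; t; b]) = H m (u ++ [:: t; s; t; a; b]).
  by apply: weq_inv_cat => //; rewrite bs at_.
(* Each word is brought to the form (braid word)(free word). *)
rewrite /ls /lg -/a -/b -/s -/t !(E0, E1, E2, E3, E4, E5, E6).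
case: (eqVneq k i) => [->|ki].
  by rewrite (ltn_eqF lt1) (ltn_eqF lt3).
case: (k =P i.+1) => // _; case: (k =P i.+2) => // _.
(* Only row [i.+2] is left: its two sides agree up to terms that cancel. *)
have sum_id (A B C D E F K : V) :
    A + B - C + D - E = A + F - K + (B + D - F) - (C + E - K).
  rewrite [RHS]addrAC opprB [A + F - K + _]addrA subrK.
  rewrite [RHS]addrAC [B + D - F]addrC [A + F + _]addrA addrK.
  by rewrite [A + (_ + _)]addrA opprD addrA (addrAC (A + B)).
exact: sum_id.
Qed.

Lemma weq_word_op u v H : weq n u v -> weq_inv H ->
  word_op u H = word_op v H.
Proof.
move=> uv; elim: uv H => {u v}.
- by [].
- by move=> u v _ IH H Hi; rewrite IH.
- by move=> u v w _ IHu _ IHv H Hi; rewrite IHu ?IHv.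
- move=> u u' v v' _ IHu _ IHv H Hi.
  by rewrite !word_op_cat IHv ?IHu //; apply: word_op_inv.
- move=> [k|i] b H Hi //=; case: (boolP (i < n.-1)%N) => lti;
    rewrite ?(negbTE lti) ?lti //.
  by case: b; [apply: sigma_opK | apply: sigmaV_opK].
move=> _ _ [i j|i j|i|i|i j] /=.
- move=> lti ltj; case/orP => ltij H Hi; rewrite /word_op /= lti ltj.
    exact: sigma_op_far.
  by symmetry; apply: sigma_op_far.
- move=> lti ltj; case/orP => /eqP ij H Hi; subst; rewrite /word_op /= lti ltj.
    exact: sigma_op_braid.
  by symmetry; apply: sigma_op_braid.
(* In the mixed relations the free letters act as the identity, so both sides give the same
   operator. *)
all: by [].
Qed.

End Operators.

(** The operators only add and subtract values, so they commute with additive maps on the values. *)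
Lemma word_op_morph (V W : zmodType) (f : {additive V -> W}) w
    (H : nat -> word -> V) k u :
  word_op w (fun k u => f (H k u)) k u = f (word_op w H k u).
Proof.
suff -> : word_op w (fun k u => f (H k u)) =
  fun k u => f (word_op w H k u) by [].
elim: {k u} w => //= -[[j|i] b] w /= -> //; case: ifP => // _.
apply/funext => k; apply/funext => u.
by case: b; rewrite /sigma_op /sigmaV_op; do ![case: ifP => _];
  rewrite ?(raddfB, raddfD).
Qed.

(** Left and right translations commute. *)
Lemma word_op_translate (V : zmodType) v w (H : nat -> word -> V) k u :
  word_op w (fun k u => H k (v ++ u)) k u = word_op w H k (v ++ u).
Proof.
suff -> : word_op w (fun k u => H k (v ++ u)) =
  fun k u => word_op w H k (v ++ u) by [].
elim: {k u} w => //= -[[j|i] b] w /= -> //; case: ifP => // _.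
by case: b; rewrite /sigma_op /sigmaV_op; apply/funext => k; apply/funext => u;
  rewrite -!catA.
Qed.

(** * Normality of F_n and locality of the operators *)

Definition free_letter (l : letter) : bool :=
  if l.1 is gF k then k < n else false.

Lemma free_winv f : all free_letter f -> all free_letter (winv f).
Proof. by rewrite /winv all_rev all_map. Qed.

(** Normality of F_n, one letter at a time: the relations give conjugation by sigma_i, and solving
    them gives conjugation by its inverse. *)
Lemma free_braid_swap k b i c : k < n -> i < n.-1 ->
  exists2 f, all free_letter f &
    weq n [:: (gF k, b); (gB i, c)] ((gB i, c) :: f).
Proof.
move=> ltk lti; have ltk1 : i.+1 < n by lia.
have ltk0 : i < n by lia.
have rel x z : defrel n (x ++ ls i) (ls i ++ z) ->
    weq n (x ++ ls i) (ls i ++ z) /\ weq n (z ++ lsi i) (lsi i ++ x).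
  by move=> xz; have e := weq_rel xz; split; [|exact: weq_conj_sym e].
have [_ V1] := rel _ _ (rel_g1 lti).
have [R2 V2] := rel (lg i) (lg i ++ lg i.+1 ++ lgi i) (rel_g2 lti).
suff [f Ff e] : exists2 f, all free_letter f &
    weq n (lg k ++ [:: (gB i, c)]) ([:: (gB i, c)] ++ f).
  case: b; last by exists f.
  by exists (winv f); [exact: free_winv | exact: (weq_conj_winv e)].
have [->|ki] := eqVneq k i.
  case: c.
    by exists (lg i.+1); rewrite //= andbT.
  by exists (lg i ++ lg i.+1 ++ lgi i); rewrite //= /free_letter /= ltk0 ltk1.
have [->|ki1] := eqVneq k i.+1.
  case: c; last first.
    by exists (lg i); [rewrite /= andbT | exact/weq_rel/rel_g1].
  (* Write $x \mapsto \sigma_i x \sigma_i^{-1}$ for the conjugation. It sends $g_i$ to $g_{i+1}$ and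
     $g_i g_{i+1} g_i^{-1}$ to $g_i$, hence $g_{i+1} = g_i^{-1}(g_i g_{i+1} g_i^{-1})g_i$ to
     $g_{i+1}^{-1} g_i g_{i+1}$. *)
  exists (lgi i.+1 ++ lg i ++ lg i.+1);
    first by rewrite //= /free_letter /= ltk0 ltk1.
  have V1' := weq_conj_winv V1.
  have e : weq n (lg i.+1 ++ lsi i)
    (lgi i ++ ((lg i ++ lg i.+1 ++ lgi i) ++ lg i ++ lsi i)).
    by rewrite /= !(weq_cancel_cons _ _ true).
  by rewrite e V1 (catA _ (lsi i)) V2 -catA catA V1' -!catA.
have [R3 V3] := rel _ _ (rel_g3 lti ltk ki ki1).
by exists (lg k); [rewrite /= andbT | case: c].
Qed.

Section Locality.
Variable P : word -> Prop.
Hypothesis P_weq : forall u v, weq n u v -> P u -> P v.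
Hypothesis P_g : forall u k b, k < n -> P u -> P (u ++ [:: (gF k, b)]).

(** Past the first letter of [w] the inserted letter becomes a free word, whose letters the
    induction hypothesis inserts one by one into the rest of [w]. *)
Lemma insert_g w u k b : braid_word n w -> k < n ->
  P (u ++ w) -> P (u ++ (gF k, b) :: w).
Proof.
elim: w u k b => [|[[//|i] c] w IHw] u k b /=.
  by rewrite cats0 => *; apply: P_g.
case/andP=> lti bw ltk; rewrite -cat_rcons => Pw.
have [f Ff e] := free_braid_swap b c ltk lti.
suff : P (rcons u (gB i, c) ++ f ++ w).
  by apply: P_weq; rewrite cat_rcons -cat_cons -e.
elim: f {e} (rcons u _) Ff Pw => //= -[[j|//] b'] f IHf v /andP[ltj Ff] Pw.
by rewrite -cat_rcons; apply: IHf => //; rewrite cat_rcons; apply: IHw.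
Qed.

(** A letter operator evaluates its argument at [u] followed by that letter, with at most one free
    letter inserted; [insert_g] keeps such points inside [P]. *)
Lemma word_op_local (V : zmodType) w (H1 H2 : nat -> word -> V) k u :
  braid_word n w ->
  (forall l v, P v -> H1 l v = H2 l v) -> P (u ++ w) ->
  word_op w H1 k u = word_op w H2 k u.
Proof.
move=> bw eqH; elim: w k u bw => [|[[//|i] b] w IHw] k u /=.
  by rewrite cats0 => _; apply: eqH.
case/andP=> lti bw; rewrite lti => Pw.
have ltk0 : i < n by lia.
have Ps l : word_op w H1 l (u ++ [:: (gB i, b)]) =
            word_op w H2 l (u ++ [:: (gB i, b)]).
  by apply: IHw; rewrite // -catA.
case: b Pw Ps => Pw Ps; rewrite /sigma_op /sigmaV_op !Ps.
  rewrite (IHw i (u ++ _ ++ _)) // -!catA.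
  by apply: insert_g; rewrite //= lti.
rewrite (IHw i.+1 (u ++ _ ++ _)) // -!catA catA; apply: insert_g => //.
by rewrite -catA.
Qed.

End Locality.

(** * Matrices over the group ring as operators *)

Section Evaluation.
Variable V : zmodType.
Local Open Scope ring_scope.

(** The value at 1 of [x] acting on [h] by right translation; replacing [h] by [fun v => h (u ++ v)]
    gives the value at [u]. *)
Definition greval (h : word -> V) (x : gring) : V := \sum_(p <- x) h p.2 *~ p.1.

Lemma greval_mul h x y :
  greval h (grmul x y) = greval (fun u => greval (fun v => h (u ++ v)) y) x.
Proof.
rewrite /greval /grmul big_allpairs_dep; apply: eq_bigr => p _.
rewrite mulrz_suml; apply: eq_bigr => q _.
by rewrite mulrC mulrzA.
Qed.

Lemma greval_sum h (m : nat) (F : 'I_m -> gring) :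
  greval h (\big[cat/[::]]_(k < m) F k) = \sum_(k < m) greval h (F k).
Proof.
by elim/big_rec2: _ => [|k x y _ <-]; rewrite /greval ?big_nil ?big_cat.
Qed.

Lemma greval_sumf (m : nat) (F : 'I_m -> word -> V) x :
  greval (fun u => \sum_(k < m) F k u) x = \sum_(k < m) greval (F k) x.
Proof.
rewrite /greval exchange_big; apply: eq_bigr => p _ /=.
by rewrite mulrz_suml.
Qed.

Lemma sum_two_terms (I : finType) (F : I -> V) (i0 i1 : I) : i1 != i0 ->
  (forall m, m != i0 -> m != i1 -> F m = 0) -> \sum_m F m = F i0 + F i1.
Proof.
move=> i10 F0.
rewrite (bigD1 i0) //= (bigD1 i1) //= big1 ?addr0 // => m /andP[m0 m1].
exact: F0.
Qed.

(** Rows [i] and [i.+1] of the matrix are supported in columns [i] and [i.+1], every other row on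
    the diagonal. *)
Lemma letter_op_greval i b (H : nat -> word -> V) (k : 'I_n) u : (i < n.-1)%N ->
  \sum_(m < n) greval (fun v => H m (u ++ v)) (phi_letter n (gB i, b) k m) =
  letter_op (gB i, b) H k u.
Proof.
move=> lti; rewrite /= lti.
have lt0 : (i < n)%N by lia.
have lt1 : (i.+1 < n)%N by lia.
have ne : (i == i.+1) = false by lia.
have ne' : (i.+1 == i) = false by lia.
have [ki|ki] := boolP ((k == i :> nat) || (k == i.+1 :> nat)).
  have i10 : Ordinal lt1 != Ordinal lt0 by rewrite -val_eqE /= ne'.
  rewrite (sum_two_terms i10); last first.
    move=> m; rewrite -!val_eqE /= => /negbTE m0 /negbTE m1.
    have km : k == m = false.
      by apply/negbTE; apply: contraL ki => /eqP ->; rewrite m0 m1.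
    by case: b; rewrite !mxE m0 m1 !andbF km /greval big_nil.
  case/orP: ki => /eqP kE; case: b; rewrite !mxE kE /= !eqxx /= ?ne ?ne' /=;
    rewrite /sigma_op /sigmaV_op ?eqxx ?ne' /greval /= !(big_cons, big_nil) /=;
    by rewrite ?mulrN1z ?(mulr1z, addr0, add0r) ?addrA.
have [/negbTE k0 /negbTE k1] := norP ki.
rewrite (bigD1 k) //= big1 => [|m mk]; last first.
  by case: b; rewrite !mxE k0 k1 /= eq_sym (negbTE mk) /greval big_nil.
case: b; rewrite !mxE /sigma_op /sigmaV_op k0 k1 eqxx.
all: by rewrite /greval /= big_seq1 /= mulr1z addr0 ?cats0.
Qed.

Lemma word_op_greval w (H : nat -> word -> V) (k : 'I_n) u : braid_word n w ->
  \sum_(m < n) greval (fun v => H m (u ++ v)) (phi n w k m) = word_op w H k u.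
Proof.
elim: w k u => [|[[//|i] b] w IHw] k u.
  move=> _; rewrite (bigD1 k) //= big1 => [|m mk].
    by rewrite mxE eqxx /greval big_seq1 /= mulr1z addr0 cats0.
  by rewrite mxE eq_sym (negbTE mk) /greval big_nil.
case/andP=> lti bw; rewrite -[RHS]/(letter_op (gB i, b) (word_op w H) k u).
rewrite -letter_op_greval //.
(* Products in the group ring act by composition, so the matrix product becomes a double sum whose
   inner part is the induction hypothesis. *)
transitivity (\sum_(m < n) \sum_(l < n) greval
   (fun v => greval (fun v' => H m ((u ++ v) ++ v')) (phi n w l m))
   (phi_letter n (gB i, b) k l)).
  apply: eq_bigr => m _; rewrite [phi _ _]/= mxE greval_sum.
  apply: eq_bigr => l _; rewrite greval_mul.
  by apply: eq_bigr => p _; congr (_ *~ _); apply: eq_bigr => q _; rewrite catA.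
rewrite exchange_big; apply: eq_bigr => l _ /=.
rewrite -greval_sumf; apply: eq_bigr => p _.
by rewrite IHw.
Qed.

End Evaluation.

End WordAction.

Lemma greval_raddf (V W : zmodType) (f : {additive V -> W}) h x :
  greval (fun u => f (h u)) x = f (greval h x).
Proof.
by rewrite /greval raddf_sum; apply: eq_bigr => p _; rewrite raddfMz.
Qed.

(** A column concentrated in position [l], used to read off single entries of [phi]. *)
Definition delta_fun (V : zmodType) (l : nat) (h : word -> V) :
  nat -> word -> V := fun m u => if m == l then h u else 0%R.

Lemma word_op_delta (V : zmodType) n (h : word -> V) w (k l : 'I_n) :
  braid_word n w -> word_op n w (delta_fun l h) k [::] = greval h (phi n w k l).
Proof.
move=> bw; rewrite -word_op_greval // (bigD1 l) //= big1 => [|m ml].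
  by rewrite addr0 /delta_fun eqxx.
by rewrite /greval /delta_fun val_eqE (negbTE ml) big1 // => p _;
  rewrite mul0rz.
Qed.

(** * The representation on the sum of n copies of V *)

Section InducedRepresentation.
Variables (K : comUnitRingType) (n d : nat) (G : word -> Prop).
Variable rho : word -> 'M[K]_d.
Hypothesis Gsub : braid_subgroup n G.
Hypothesis rho_weq : forall u v, inFG n G u -> weq n u v -> rho u = rho v.
Hypothesis rho_cat : forall u v, inFG n G u -> inFG n G v ->
  rho (u ++ v) = (rho u *m rho v)%R.
Hypothesis rho_nil : rho [::] = 1%:M%R.
Local Open Scope ring_scope.

Let G_braid w : G w -> braid_word n w.
Proof. by case: Gsub => + _ _ _ _; apply. Qed.

(** Extension by zero turns the filtered sum of [rho_lin] into a plain evaluation. *)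
Definition rho_ext u : 'M[K]_d := if `[< inFG n G u >] then rho u else 0.

Lemma rho_linE x : rho_lin n G rho x = greval rho_ext x.
Proof.
rewrite /rho_lin /greval big_mkcond; apply: eq_bigr => p _.
by rewrite /rho_ext; case: ifP; rewrite ?mul0rz // scaler_int.
Qed.

Lemma rho_ext_weq u v : weq n u v -> rho_ext u = rho_ext v.
Proof.
move=> uv; rewrite /rho_ext; case: asboolP => Fu; case: asboolP => Fv //.
- exact: rho_weq.
- by case: Fv; apply: inFG_weq uv Fu.
- by case: Fu; apply: inFG_weq (weq_sym uv) Fv.
Qed.

Lemma word_op_local_FG (V : zmodType) w (H1 H2 : nat -> word -> V) k :
  G w -> (forall l v, inFG n G v -> H1 l v = H2 l v) ->
  word_op n w H1 k [::] = word_op n w H2 k [::].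
Proof.
move=> Gw eqH; apply: (@word_op_local n (inFG n G)) => //.
- by move=> u v; apply: inFG_weq.
- move=> u j [] ltj Fu; apply: inFG_cat => //; last exact: inFG_g.
  exact: inFG_inv (inFG_g G ltj).
- exact: G_braid.
- exact: inFG_G.
Qed.

Lemma phi_in_ZFG w (k l : 'I_n) : G w -> in_ZFG n G (phi n w k l).
Proof.
move=> Gw v; apply: contra_neqP => Fv.
(* Pairing with the indicator of the class of [v] extracts the coefficient; when [v] is not in
   [inFG], this indicator vanishes there, and locality replaces it by 0. *)
pose h u : int := if `[< weq n u v >] then 1 else 0.
have -> : grcoef n (phi n w k l) v = greval h (phi n w k l).
  rewrite /grcoef /greval big_mkcond; apply: eq_bigr => p _.
  by rewrite /h; case: ifP; rewrite ?mul0rz // intz.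
rewrite -word_op_delta; last exact: G_braid.
rewrite (@word_op_local_FG _ w _ (fun _ _ => 0)) // => [|m u Fu].
  rewrite -word_op_greval ?G_braid // big1 // => m _.
  by rewrite /greval big1 // => p _; rewrite mul0rz.
rewrite /delta_fun /h; case: ifP => // _; case: asboolP => // uv.
by case: Fv; apply: inFG_weq uv Fu.
Qed.

Lemma rho_plus_weq u v : G u -> G v -> weq n u v ->
  rho_plus n G rho u = rho_plus n G rho v.
Proof.
move=> Gu Gv uv; apply: eq_mxblock => k l.
rewrite !rho_linE -!word_op_delta ?G_braid // (weq_word_op uv) //.
move=> m u' v' uv'; rewrite /delta_fun; case: ifP => // _.
exact: rho_ext_weq.
Qed.

Lemma rho_plus_nil : rho_plus n G rho [::] = 1%:M.
Proof.
rewrite -mxdiagZ /mxdiag; apply: eq_mxblock => k l.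
rewrite rho_linE -word_op_delta //= /delta_fun val_eqE.
case: eqP => // _; rewrite conform_mx_id /rho_ext asboolT //.
exact: inFG_nil.
Qed.

Lemma rho_plus_cat u v : G u -> G v ->
  rho_plus n G rho (u ++ v) = rho_plus n G rho u *m rho_plus n G rho v.
Proof.
move=> Gu Gv; rewrite mul_mxblock; apply: eq_mxblock => k l.
have Guv : G (u ++ v) by case: Gsub => _ _ Gcat _ _; apply: Gcat.
(* [M m] is the [(m, l)] block for [v]. At points [w] of [inFG] the inner operator takes the value
   [rho_ext w *m M m], so the outer one yields the block product. *)
pose M m := word_op n v (delta_fun l rho_ext) m [::].
rewrite rho_linE -word_op_delta ?G_braid // word_op_cat.
rewrite (@word_op_local_FG _ u _ (fun m w => rho_ext w *m M m)) // => [|m w Fw].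
  rewrite -word_op_greval ?G_braid //; apply: eq_bigr => m _.
  rewrite !rho_linE -[greval _ (phi n v m l)]word_op_delta ?G_braid //.
  exact: (greval_raddf (mulmxr (M m))).
(* Moving the base point from [w] to 1 lets multiplicativity of [rho] pull out the factor
   [rho_ext w]. *)
rewrite -[w in LHS]cats0 -word_op_translate.
rewrite (@word_op_local_FG _ v _
  (fun j w' => rho_ext w *m delta_fun l rho_ext j w')) //.
  by rewrite (word_op_morph n (mulmx (rho_ext w))).
move=> j w' Fw'; rewrite /delta_fun; case: ifP; rewrite ?mulmx0 // => _.
have Fww' : inFG n G (w ++ w') by exact: inFG_cat.
by rewrite /rho_ext !asboolT ?rho_cat.
Qed.

Lemma rho_plus_unit u : G u -> rho_plus n G rho u \in unitmx.
Proof.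
move=> Gu; have [_ G1 Gcat Gwinv _] := Gsub; have Gi := Gwinv _ Gu.
have : rho_plus n G rho u *m rho_plus n G rho (winv u) = 1%:M.
  rewrite -rho_plus_cat // -rho_plus_nil; apply: rho_plus_weq => //.
    exact: Gcat.
  exact: weq_winvr.
by case/mulmx1_unit.
Qed.

End InducedRepresentation.

(* V = C^d with C = R[i] (R a model of the reals); End(V) = 'M_d. *)
Theorem theorem3p1 (R : realType) (n : nat) (G : word -> Prop) (d : nat)
    (rho : word -> 'M[R[i]]_d) :
  2 <= n ->
  braid_subgroup n G ->
  (* rho is a representation of F_n ⋊ G on V *)
  (forall u v, inFG n G u -> weq n u v -> rho u = rho v) ->
  (forall u v, inFG n G u -> inFG n G v -> rho (u ++ v) = (rho u *m rho v)%R) ->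
  rho [::] = 1%:M%R ->
  (* every entry of phi(beta) lies in Z[F_n ⋊ G] *)
  (forall beta, G beta -> forall k l : 'I_n, in_ZFG n G (phi n beta k l))
  (* rho^+ is a well-defined representation G -> GL(V^{+n}) *)
  /\ (forall beta beta', G beta -> G beta' -> weq n beta beta' ->
        rho_plus n G rho beta = rho_plus n G rho beta')
  /\ (forall beta, G beta -> rho_plus n G rho beta \in unitmx)
  /\ rho_plus n G rho [::] = 1%:M%R
  /\ (forall beta beta', G beta -> G beta' ->
        rho_plus n G rho (beta ++ beta') =
        (rho_plus n G rho beta *m rho_plus n G rho beta')%R).
Proof.
move=> _ Gsub rho_weq rho_cat rho_nil; split=> [beta Gb k l|].
  exact: phi_in_ZFG.
split; first by move=> *; apply: rho_plus_weq.
split; first by move=> *; apply: rho_plus_unit.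
by split; [exact: rho_plus_nil | move=> *; apply: rho_plus_cat].
Qed.
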